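(* Let $A,B\in\mathbb{M}_d$ be positive semidefinite. Then $$\operatorname{Tr}(AB)=\frac12\left\{\|A+B\|_2^2-\|A\vee B\|_2^2-\|A\wedge B\|_2^2\right\}.$$
   Context: $\mathbb{M}_d$ is the algebra of complex $d\times d$ matrices, $\operatorname{Tr}$ is the unnormalized trace, and $\|X\|_2=(\operatorname{Tr}X^*X)^{1/2}$ is the Hilbert–Schmidt (Frobenius) norm. For a Hermitian $X\in\mathbb{M}_d$ and $t\in\mathbb{R}$, $E_X(t)=\mathbf{1}_{(t,\infty)}(X)$ is the orthogonal projection onto the span of the eigenvectors of $X$ with eigenvalue $>t$. The spectral order on Hermitian matrices is: $A\preceq B$ iff $E_A(t)\le E_B(t)$ for all $t\in\mathbb{R}$. With this order the Hermitian matrices in $\mathbb{M}_d$ form a lattice (Olson); $A\vee B$ and $A\wedge B$ denote the supremum (join) and infimum (meet). They are characterized by $E_{A\vee B}(t)=E_A(t)\vee E_B(t)$ and $E_{A\wedge B}(t)=E_A(t)\wedge E_B(t)$ for all $t\in\mathbb{R}$, where for orthogonal projections $P,Q$ the projections $P\vee Q$ and $P\wedge Q$ are the orthogonal projections onto $\operatorname{Ran}P+\operatorname{Ran}Q$ and $\operatorname{Ran}P\cap\operatorname{Ran}Q$, respectively. *)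

(* Defs.v *)
From mathcomp Require Import all_boot all_order all_algebra.
From mathcomp Require Import sesquilinear spectral complex.
From mathcomp Require Import classical_sets reals.

Set Implicit Arguments.
Unset Strict Implicit.
Unset Printing Implicit Defensive.

Import Order.TTheory GRing.Theory Num.Theory.
Local Open Scope ring_scope.
Local Open Scope complex_scope.
Local Open Scope sesquilinear_scope.
Local Open Scope classical_set_scope.

(* [0 <= z] in [R[i]] says that z is real and nonnegative. *)
Definition psdmx (R : realType) (d : nat) (X : 'M[R[i]]_d) : Prop :=
  X \is hermsymmx /\ forall v : 'cV[R[i]]_d, 0 <= (v ^t* *m X *m v) 0 0.

Definition loewner_le (R : realType) (d : nat) (X Y : 'M[R[i]]_d) : Prop :=
  psdmx (Y - X).

(* Subspaces are row spaces, so [eigenspace X a] is spanned by the rows u with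
   u *m X = a *: u. For Hermitian X these are the adjoints v ^t* of the column
   eigenvectors v. [spectral_diag X] lists the eigenvalues of a normal matrix;
   for Hermitian X they are real, and the order of [R[i]] on them is the order
   of R. *)
Definition eigenspan_gt (R : realType) (d : nat) (X : 'M[R[i]]_d) (t : R) :
    'M[R[i]]_d :=
  (\sum_(i < d | (t%:C < spectral_diag X 0 i)%R)
     eigenspace X (spectral_diag X 0 i))%MS.

(* An orthogonal projection P is Hermitian, so v ^t* *m P is the adjoint of
   P *m v: the projection onto a row space is the same matrix as the projection
   of column vectors onto the space of adjoints. *)
Definition spectral_proj (R : realType) (d : nat) (X : 'M[R[i]]_d) (t : R) :
    'M[R[i]]_d :=
  proj_ortho (eigenspan_gt X t).

Definition spectral_le (R : realType) (d : nat) (A B : 'M[R[i]]_d) : Prop :=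
  forall t : R, loewner_le (spectral_proj A t) (spectral_proj B t).

Definition is_spectral_join (R : realType) (d : nat) (A B J : 'M[R[i]]_d) :
    Prop :=
  [/\ J \is hermsymmx, spectral_le A J, spectral_le B J &
      forall K : 'M[R[i]]_d, K \is hermsymmx ->
        spectral_le A K -> spectral_le B K -> spectral_le J K].

Definition is_spectral_meet (R : realType) (d : nat) (A B M : 'M[R[i]]_d) :
    Prop :=
  [/\ M \is hermsymmx, spectral_le M A, spectral_le M B &
      forall K : 'M[R[i]]_d, K \is hermsymmx ->
        spectral_le K A -> spectral_le K B -> spectral_le K M].

(* For Hermitian A and B the join and the meet exist (Olson) and are unique;
   the default value 0 is only reached outside the Hermitian matrices. *)
Definition spectral_join (R : realType) (d : nat) (A B : 'M[R[i]]_d) :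
    'M[R[i]]_d :=
  xget 0 [set J | is_spectral_join A B J].

Definition spectral_meet (R : realType) (d : nat) (A B : 'M[R[i]]_d) :
    'M[R[i]]_d :=
  xget 0 [set M | is_spectral_meet A B M].

Definition hs_norm (R : realType) (d : nat) (X : 'M[R[i]]_d) : R[i] :=
  sqrtC (\tr (X ^t* *m X)).

(* Main.v *)
Require Import Defs.
From mathcomp Require Import all_boot all_order all_algebra.
From mathcomp Require Import complex reals.
From mathcomp Require Import sesquilinear spectral classical_sets zify.

(** For a Hermitian X let S_X(t) be the span of the eigenvectors of X with
    eigenvalue > t; its dimension is the number of eigenvalues of X above t,
    counted with multiplicity ([rank_eigenspan_gt]).  Since
    S_{A \/ B}(t) = S_A(t) + S_B(t) and S_{A /\ B}(t) = S_A(t) :&: S_B(t), the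
    formula dim (U + V) + dim (U :&: V) = dim U + dim V says that the
    eigenvalues of A \/ B and of A /\ B, taken together, are exactly those of
    A and of B, taken together ([perm_eigs_join_meet]).  Hence
    ||A \/ B||^2 + ||A /\ B||^2 = ||A||^2 + ||B||^2, both sides being the sum
    of the squares of these eigenvalues, and the theorem follows by expanding
    ||A + B||^2.

    The remaining work is to show that the join and the meet exist and have
    these spectral subspaces.  The spectral order is inclusion of the spaces
    S_X(t) ([spectral_leP]), so it is enough to realize the families
    t |-> S_A(t) + S_B(t) and t |-> S_A(t) :&: S_B(t) as spectral families of
    Hermitian matrices.  They are decreasing step functions of t, jumping only
    at eigenvalues e_0 <= ... <= e_(n-1) of A and B.  With P_0 = 1 and P_(k+1)
    the orthogonal projection onto the value of the family at e_k, the
    differences P_k - P_(k+1) are pairwise orthogonal projections with sum 1,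
    and sum_k e_k (P_k - P_(k+1)) is the required matrix
    ([eigenspan_chain], [step_family_realized]). *)

Set Implicit Arguments.
Unset Strict Implicit.
Unset Printing Implicit Defensive.

Import Order.TTheory GRing.Theory Num.Theory.
Local Open Scope ring_scope.
Local Open Scope complex_scope.
Local Open Scope sesquilinear_scope.

(** * Orthogonal projections and inclusion of subspaces *)

Section HermitianMatrices.
Variables (C : numClosedFieldType) (d : nat).
Implicit Types X : 'M[C]_d.

Lemma hermsymmxP X : reflect (X ^t* = X) (X \is hermsymmx).
Proof.
by apply: (iffP (is_hermitianmxP _ _ _)); rewrite expr0 scale1r => /esym.
Qed.

Lemma trmxC_mul m n p (U : 'M[C]_(m, n)) (V : 'M[C]_(n, p)) :
  (U *m V) ^t* = V ^t* *m U ^t*.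
Proof. by rewrite trmx_mul map_mxM. Qed.

Lemma trmxCB m n (U V : 'M[C]_(m, n)) : (U - V) ^t* = U ^t* - V ^t*.
Proof. by rewrite linearB map_mxB. Qed.

(** The rows of 1 - P are orthogonal to U and those of P lie in U, so
    (1 - P) P^* = 0: P^* is P P^*, which is Hermitian. *)
Lemma proj_ortho_trmxC m (U : 'M[C]_(m, d)) :
  (proj_ortho U) ^t* = proj_ortho U.
Proof.
have PPt : (proj_ortho U) ^t* = proj_ortho U *m (proj_ortho U) ^t*.
  have /submxP[M PM] : (proj_ortho U <= U)%MS by rewrite proj_orthoE.
  have /orthomx1P := proj_ortho_compl_sub U 1%:M.
  rewrite mul1mx mulmxBl mul1mx => /subr0_eq UPU.
  by rewrite [in LHS]PM [X in _ *m X ^t*]PM !trmxC_mul mulmxA -UPU.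
by rewrite PPt -[LHS]trmxCK trmxC_mul trmxCK -PPt trmxCK.
Qed.

Lemma proj_orthoB_hermsymmx m n (U : 'M[C]_(m, d)) (V : 'M[C]_(n, d)) :
  proj_ortho V - proj_ortho U \is hermsymmx.
Proof. by apply/hermsymmxP; rewrite trmxCB !proj_ortho_trmxC. Qed.

Lemma proj_orthoS_mulr m n (U : 'M[C]_(m, d)) (V : 'M[C]_(n, d)) :
  (U <= V)%MS -> proj_ortho U *m proj_ortho V = proj_ortho U.
Proof. by move=> UV; rewrite proj_ortho_id // proj_orthoE. Qed.

Lemma proj_orthoS_mull m n (U : 'M[C]_(m, d)) (V : 'M[C]_(n, d)) :
  (U <= V)%MS -> proj_ortho V *m proj_ortho U = proj_ortho U.
Proof.
move=> UV; rewrite -[LHS]trmxCK trmxC_mul !proj_ortho_trmxC.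
by rewrite proj_orthoS_mulr // proj_ortho_trmxC.
Qed.

Lemma mul_trmxC_ge0 (u : 'rV[C]_d) : 0 <= (u *m u ^t*) 0 0.
Proof.
rewrite -dotmxE; case: (eqVneq u 0) => [->|/dotmx_is_dotmx/ltW//].
by rewrite dotmxE mul0mx mxE.
Qed.

(** If Q - P >= 0 and u lies in U, then u = u P and the squared norm of u - u Q
    is u (P - Q) u^* <= 0.  Conversely, when U <= V the difference Q - P is a
    Hermitian idempotent. *)
Lemma proj_orthoB_ge0P m n (U : 'M[C]_(m, d)) (V : 'M[C]_(n, d)) :
  (forall v : 'cV[C]_d,
     0 <= (v ^t* *m (proj_ortho V - proj_ortho U) *m v) 0 0) <->
  (U <= V)%MS.
Proof.
split=> [PQ|UV v].
  apply/row_subP => i; set u := row i U.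
  suff /subr0_eq -> : u - u *m proj_ortho V = 0 by exact: proj_ortho_sub.
  apply/eqP; apply: contraT => /dotmx_is_dotmx; rewrite dotmxE.
  have := PQ (u ^t*); rewrite trmxCK mulmxBr mulmxBl.
  have -> : u *m proj_ortho U = u by rewrite proj_ortho_id // row_sub.
  have := proj_ortho_proj V; have := proj_ortho_trmxC V => /=.
  move: (proj_ortho V) => Q Qt QQ uPQ.
  have -> : (u - u *m Q) *m (u - u *m Q) ^t* =
      - (u *m Q *m u ^t* - u *m u ^t*).
    rewrite trmxCB trmxC_mul Qt mulmxBl !mulmxBr !mulmxA.
    by rewrite -[u *m Q *m Q]mulmxA QQ subrr subr0 opprB.
  by rewrite mxE oppr_gt0 => /(le_lt_trans uPQ); rewrite ltxx.
have := (proj_orthoS_mulr UV, proj_orthoS_mull UV).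
have := (proj_ortho_trmxC U, proj_ortho_trmxC V).
have := (proj_ortho_proj U, proj_ortho_proj V) => /=.
move: (proj_ortho U) (proj_ortho V) => P Q [PP QQ] [Pt Qt] [PQ QP].
have DD : (Q - P) *m (Q - P) = Q - P.
  by rewrite mulmxBl !mulmxBr PP QQ PQ QP subrr subr0.
have Dt : (Q - P) ^t* = Q - P by rewrite trmxCB Pt Qt.
rewrite -DD mulmxA -mulmxA -{2}Dt -{2}[v]trmxCK -trmxC_mul.
exact: mul_trmxC_ge0.
Qed.

(** * Spectral subspaces of a normal matrix *)

Definition eigenspan (p : pred C) X : 'M[C]_d :=
  (\sum_(i < d | p (spectral_diag X 0 i))
     eigenspace X (spectral_diag X 0 i))%MS.

Definition spectrum_ind (p : pred C) X : 'M[C]_d :=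
  diag_mx (\row_i (p (spectral_diag X 0 i))%:R).

Lemma spectralmx_eigen X : X \is normalmx ->
  spectralmx X *m X = diag_mx (spectral_diag X) *m spectralmx X.
Proof.
move=> /orthomx_spectralP {2}->.
by rewrite !mulmxA mulmxV ?spectral_unit // mul1mx.
Qed.

(** The rows of [spectralmx X] are an orthonormal basis of eigenvectors, and
    [spectrum_ind p X] keeps those whose eigenvalue satisfies p.  A vector of
    the eigenspace of z has nonzero coordinates in this basis only at the
    eigenvectors of eigenvalue z. *)
Lemma eigenspanE p X : X \is normalmx ->
  (eigenspan p X :=: spectrum_ind p X *m spectralmx X)%MS.
Proof.
move=> nX; set Q := spectralmx X; set L := spectral_diag X.
apply/eqmxP/andP; split.
  apply/sumsmx_subP => i pi; rewrite -/L.
  set E := eigenspace X _; pose c := E *m invmx Q.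
  have EE : E = c *m Q by rewrite mulmxKV // spectral_unit.
  have /eigenspaceP EX := submx_refl E.
  suff cD : c = c *m spectrum_ind p X by rewrite EE cD -mulmxA submxMl.
  have cL : c *m diag_mx L = L 0 i *: c.
    rewrite -(mulmxK (spectral_unit X) (c *m _)).
    rewrite -[c *m _ *m spectralmx X]mulmxA.
    by rewrite -spectralmx_eigen // mulmxA -EE EX -scalemxAl.
  move: c {EE} cL => c cL.
  apply/matrixP => k j; rewrite mul_mx_diag !mxE -/L.
  case: (boolP (p (L 0 j))) => [_|npj]; first by rewrite mulr1.
  have /matrixP/(_ k j) := cL.
  rewrite mul_mx_diag mxE [in RHS]mxE [RHS]mulrC => /eqP.
  rewrite -subr_eq0 -mulrBr mulf_eq0 => /orP[/eqP ->|]; first by rewrite mul0r.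
  by rewrite subr_eq0 => /eqP Lji; rewrite Lji pi in npj.
apply/row_subP => i; rewrite row_mul row_diag_mx mxE.
rewrite -scalemxAl -rowE.
case: (boolP (p _)) => pi; last by rewrite scale0r sub0mx.
rewrite scale1r (sumsmx_sup i) //; apply/eigenspaceP.
by rewrite -row_mul spectralmx_eigen // row_mul row_diag_mx -scalemxAl -rowE.
Qed.

(** Left multiplication by the invertible [spectralmx X] does not change a row
    space.  The hypothesis says that P fixes the eigenvectors of X whose
    eigenvalue satisfies p and kills the other ones. *)
Lemma eigenspan_projE p X P : X \is normalmx ->
    spectralmx X *m P = spectrum_ind p X *m spectralmx X ->
  (eigenspan p X :=: P)%MS.
Proof.
move=> nX QP; apply: eqmx_trans (eigenspanE p nX) _; rewrite -QP.
by apply: eqmxMfull; rewrite row_full_unit spectral_unit.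
Qed.

(** The nonzero rows of the matrix are the canonical basis vectors indexed by
    f, which form an orthonormal, hence free, family. *)
Lemma mxrank_diag_ind (f : pred 'I_d) :
  \rank (diag_mx (\row_i (f i)%:R : 'rV[C]_d)) = #|f|.
Proof.
set W : 'M[C]_(#|f|, d) := rowsub enum_val 1%:M.
have uW : W \is unitarymx.
  apply/unitarymxP/matrixP => i j; rewrite mxE.
  rewrite (bigD1 (enum_val i)) //= big1 => [|k ki].
    by rewrite !mxE eqxx mul1r addr0 rmorph_nat (inj_eq enum_val_inj) eq_sym.
  by rewrite !mxE eq_sym (negPf ki) mul0r.
rewrite -(mxrank_unitary uW); apply: eqmx_rank; apply/andP; split.
  apply/row_subP => i; rewrite row_diag_mx mxE.
  case: (boolP (f i)) => fi; last by rewrite scale0r sub0mx.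
  have -> : delta_mx 0 i = row (enum_rank_in fi i) W.
    by rewrite row_rowsub enum_rankK_in // row1.
  by rewrite scale1r row_sub.
apply/row_subP => j; rewrite row_rowsub row1.
have -> : delta_mx 0 (enum_val j)
    = row (enum_val j) (diag_mx (\row_i (f i)%:R : 'rV[C]_d)).
  have fj : f (enum_val j) by exact: (enum_valP j).
  by rewrite row_diag_mx mxE fj scale1r.
exact: row_sub.
Qed.

Definition spectrum X : seq C := [seq spectral_diag X 0 i | i <- enum 'I_d].

Lemma rank_eigenspan p X : X \is normalmx ->
  \rank (eigenspan p X) = count p (spectrum X).
Proof.
move=> nX; rewrite eigenspanE //.
rewrite mxrankMfree ?row_free_unit ?spectral_unit // mxrank_diag_ind.
by rewrite count_map cardE size_filter enumT.
Qed.

Lemma mxtrace_sqr X : X \is normalmx ->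
  \tr (X *m X) = \sum_(z <- spectrum X) z ^+ 2.
Proof.
move=> nX; rewrite big_map big_enum /=.
transitivity (\tr (diag_mx (spectral_diag X) *m diag_mx (spectral_diag X))).
  have {1 2}-> := orthomx_spectralP nX.
  rewrite mxtrace_mulC !mulmxA mulmxK ?spectral_unit // mxtrace_mulC.
  by rewrite !mulmxA mulmxV ?spectral_unit // mul1mx.
rewrite mulmx_diag mxtrace_diag; apply: eq_bigr => i _.
by rewrite mxE expr2.
Qed.

Lemma mxtrace_polarization X Y :
  2^-1 * (\tr ((X + Y) *m (X + Y)) - (\tr (X *m X) + \tr (Y *m Y))) =
  \tr (X *m Y).
Proof.
rewrite mulmxDl !mulmxDr !mxtraceD [\tr (Y *m X)]mxtrace_mulC.
rewrite [\tr (X *m Y) + \tr (Y *m Y)]addrC addrACA.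
rewrite [X in X - _]addrC addrK -mulr2n.
by rewrite -[\tr _ *+ 2]mulr_natl mulKf // pnatr_eq0.
Qed.

(** * Matrices with a prescribed resolution of the identity *)

(** If u X = z u, multiplying by D k on the right gives
    (e k - z) u D_k = 0, so u = sum_k u D_k only involves the k with e k = z.
    Thus sum_(k | p (e k)) D_k fixes u when p z holds and kills it otherwise. *)
Lemma eigenspan_resolution n (D : 'I_n -> 'M[C]_d) (e : 'I_n -> C) p :
    \sum_k D k = 1%:M -> (forall k l, k != l -> D k *m D l = 0) ->
    \sum_k e k *: D k \is normalmx ->
  (eigenspan p (\sum_k e k *: D k) :=: (\sum_(k | p (e k)) D k)%R)%MS.
Proof.
set X := \sum_k _ *: _ => sumD orthD nX.
have DD k : D k *m D k = D k.
  rewrite -[RHS]mulmx1 -sumD mulmx_sumr (bigD1 k) //= big1 ?addr0 // => l lk.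
  by rewrite orthD // eq_sym.
have XD k : X *m D k = e k *: D k.
  rewrite mulmx_suml (bigD1 k) //= big1 ?addr0 -?scalemxAl ?DD // => l lk.
  by rewrite -scalemxAl orthD // scaler0.
apply: eigenspan_projE => //; apply/row_matrixP => i.
rewrite !row_mul row_diag_mx mxE -scalemxAl -rowE.
set u := row i _; set z := spectral_diag X 0 i.
have uX : u *m X = z *: u.
  by rewrite -row_mul spectralmx_eigen // row_mul row_diag_mx -scalemxAl -rowE.
have uD k : p z != p (e k) -> u *m D k = 0.
  move=> pzk; have := congr1 (mulmx^~ (D k)) uX.
  rewrite -mulmxA XD -scalemxAl -scalemxAr => /eqP.
  rewrite -subr_eq0 -scalerBl scaler_eq0 subr_eq0 => /orP[|/eqP //].
  by move=> /eqP ekz; rewrite ekz eqxx in pzk.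
rewrite mulmx_sumr; case: (boolP (p z)) => pz; last first.
  by rewrite scale0r big1 // => k pk; rewrite uD // pk (negPf pz).
rewrite scale1r -[RHS]mulmx1 -sumD mulmx_sumr.
rewrite [RHS](bigID (fun k => p (e k))) /=.
by rewrite [X in _ + X]big1 ?addr0 // => k npk; rewrite uD // pz (negPf npk).
Qed.

Lemma hermsymmx_real_sum n (D : 'I_n -> 'M[C]_d) (e : 'I_n -> C) :
    (forall k, D k ^t* = D k) -> (forall k, e k \is Num.real) ->
  \sum_k e k *: D k \is hermsymmx.
Proof.
move=> Dt er; apply/hermsymmxP; rewrite linear_sum raddf_sum.
apply: eq_bigr => k _.
by rewrite linearZ /= map_mxZ Dt; congr (_ *: _); apply/CrealP.
Qed.

(** Abel summation: a decreasing chain 1 = P_0 >= ... >= P_n = 0 of projections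
    gives the resolution of the identity D_k = P_k - P_(k+1), whose tails
    sum_(m <= k) D_k telescope to P_m. *)
Lemma eigenspan_chain n (P : nat -> 'M[C]_d) (e : nat -> C) :
    (forall k, P k ^t* = P k) ->
    (forall i j, (i <= j <= n)%N -> P i *m P j = P j /\ P j *m P i = P j) ->
    P 0%N = 1%:M -> P n = 0 -> (forall k, e k \is Num.real) ->
  exists2 X : 'M[C]_d, X \is hermsymmx &
    forall (p : pred C) m, (m <= n)%N ->
      (forall k, (k < n)%N -> p (e k) = (m <= k)%N) ->
    (eigenspan p X :=: P m)%MS.
Proof.
move=> Pt PP P0 Pn er; pose D (k : 'I_n) := P k - P k.+1.
have hX : \sum_k e (val k) *: D k \is hermsymmx.
  by apply: hermsymmx_real_sum => // k; rewrite trmxCB !Pt.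
exists (\sum_k e (val k) *: D k) => // p m mn pm.
have telescope q : (q <= n)%N -> \sum_(k < n | (q <= k)%N) D k = P q.
  move=> qn; transitivity (P q - P n); last by rewrite Pn subr0.
  transitivity (\sum_(q <= k < n) (P k - P k.+1)).
    by rewrite (big_nat_widenl _ 0) //= big_mkord.
  by rewrite -opprB -telescope_sumr // -sumrN; apply: eq_bigr => k _;
    rewrite opprB.
have -> : P m = \sum_(k < n | p (e k)) D k.
  by rewrite -telescope //; apply: eq_bigl => k; rewrite pm.
apply: eigenspan_resolution.
- by rewrite -P0 -telescope //.
- move=> [k kn] [l ln]; rewrite -val_eqE neq_ltn /D /= mulmxBl !mulmxBr.
  case/orP=> kl.
    by rewrite !(proj1 (PP _ _ _)) ?subrr //; lia.
  by rewrite !(proj2 (PP _ _ _)) ?subrr //; lia.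
- exact: hermitian_normalmx.
Qed.

End HermitianMatrices.

(** * Multisets of reals and their tail counts *)

(** The multiplicity of x is the drop of the tail count between x and any
    t < x such that no element of either sequence lies strictly between t
    and x. *)
Lemma perm_eq_count_gt (R : realDomainType) (s1 s2 : seq R) :
  (forall t, count (fun x => t < x) s1 = count (fun x => t < x) s2) ->
  perm_eq s1 s2.
Proof.
move=> c12; apply/allP => x _ /=; apply/eqP.
have [t tx sep] : exists2 t, t < x &
    {in s1 ++ s2, forall y, (t < y) = (x <= y)}.
  elim: (s1 ++ s2) => [|y s [t tx ts]]; first by exists (x - 1); rewrite ?gtrBl.
  have [xy|yx] := leP x y.
    exists t => // z; rewrite inE => /predU1P[->|/ts //].
    by rewrite xy (lt_le_trans tx).
  exists (Num.max t y); first by rewrite gt_max tx.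
  move=> z; rewrite gt_max inE => /predU1P[->|/ts ->].
    by rewrite ltxx andbF leNgt yx.
  by case: (leP x z) => // /(lt_le_trans yx) ->.
have split_count s : {subset s <= s1 ++ s2} ->
    count (fun y => t < y) s = (count_mem x s + count (fun y => (x < y)%R) s)%N.
  elim: s => //= y s IHs sub; rewrite IHs => [|z zs]; last first.
    by apply: sub; rewrite inE zs orbT.
  rewrite sep ?sub ?mem_head // le_eqVlt eq_sym.
  case: eqVneq => [->|_] /=; first by rewrite ltxx add0n addnA.
  by rewrite add0n addnCA.
have := c12 t; rewrite !split_count; last 2 first.
- by move=> y ys; rewrite mem_cat ys orbT.
- by move=> y ys; rewrite mem_cat ys.
by rewrite c12 => /addIn.
Qed.

(** * The spectral order and step families of subspaces *)

Section SpectralOrder.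
Variables (R : realType) (d : nat).
Implicit Types (X Y A B : 'M[R[i]]_d) (s : seq R) (t : R) (S : R -> 'M[R[i]]_d).

Lemma spectral_leP X Y :
  spectral_le X Y <-> forall t, (eigenspan_gt X t <= eigenspan_gt Y t)%MS.
Proof.
split=> XY t; first by apply/proj_orthoB_ge0P; have [] := XY t.
split; last exact/proj_orthoB_ge0P.
exact: proj_orthoB_hermsymmx.
Qed.

Definition eigs X : seq R := [seq complex.Re z | z <- spectrum X].

Lemma spectrumE X : X \is hermsymmx ->
  spectrum X = [seq (x%:C)%C | x <- eigs X].
Proof.
move=> hX; rewrite -map_comp -[LHS]map_id; apply/eq_in_map => z.
move=> /mapP[i _ ->] /=; apply/esym/RRe_real.
by have /mxOverP/(_ 0 i) := hermitian_spectral_diag_real hX.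
Qed.

Lemma spectral_diag_eigs X i : X \is hermsymmx ->
  exists2 x, x \in eigs X & spectral_diag X 0 i = x%:C.
Proof.
move=> hX; have : spectral_diag X 0 i \in spectrum X.
  by apply: map_f; rewrite mem_enum.
by rewrite spectrumE // => /mapP[x xX ->]; exists x.
Qed.

Lemma rank_eigenspan_gt X t : X \is hermsymmx ->
  \rank (eigenspan_gt X t) = count (fun x => t < x) (eigs X).
Proof.
move=> hX; rewrite (rank_eigenspan (fun z => t%:C < z)) ?hermitian_normalmx //.
by rewrite spectrumE // count_map; apply: eq_count => x /=; rewrite ltcR.
Qed.

(** The families that arise as t |-> S_X(t) for a Hermitian X with spectrum in
    s: the second clause makes the family constant on each interval [a, b)
    between consecutive elements of s, so it also contains right continuity. *)
Definition step_family s S :=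
  [/\ forall u t, u <= t -> (S t <= S u)%MS,
      forall u t, {in s, forall x, (u < x) = (t < x)} -> S u = S t,
      forall t, {in s, forall x, t < x} -> (1%:M <= S t)%MS &
      forall t, {in s, forall x, x <= t} -> (S t <= (0 : 'M[R[i]]_d))%MS].

Lemma step_family_eigenspan_gt s X : X \is hermsymmx ->
  {subset eigs X <= s} -> step_family s (eigenspan_gt X).
Proof.
move=> hX sXs; split=> [u t ut|u t ut|t ts|t st].
- apply/sumsmx_subP => i ti; rewrite (sumsmx_sup i) //.
  by apply: le_lt_trans ti; rewrite lecR.
- apply: eq_bigl => i; have [x xX ->] := spectral_diag_eigs i hX.
  by rewrite !ltcR ut // sXs.
- rewrite sub1mx /row_full rank_eigenspan_gt //.
  have sz : size (eigs X) = d by rewrite 2!size_map size_enum_ord.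
  rewrite -[X in _ == X]sz -all_count; apply/allP => x /sXs; exact: ts.
- apply/sumsmx_subP => i; have [x xX ->] := spectral_diag_eigs i hX.
  by rewrite ltcR ltNge st // sXs.
Qed.

Lemma step_family_adds s S1 S2 : step_family s S1 -> step_family s S2 ->
  step_family s (fun t => S1 t + S2 t)%MS.
Proof.
move=> [m1 c1 f1 z1] [m2 c2 f2 z2]; split=> [u t ut|u t ut|t ts|t st].
- by rewrite addsmxS ?m1 ?m2.
- by rewrite (c1 u t) // (c2 u t).
- by rewrite (submx_trans (f1 _ ts)) ?addsmxSl.
- by rewrite addsmx_sub z1 ?z2.
Qed.

Lemma step_family_cap s S1 S2 : step_family s S1 -> step_family s S2 ->
  step_family s (fun t => S1 t :&: S2 t)%MS.
Proof.
move=> [m1 c1 f1 z1] [m2 c2 f2 z2]; split=> [u t ut|u t ut|t ts|t st].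
- by rewrite capmxS ?m1 ?m2.
- by rewrite (c1 u t) // (c2 u t).
- by rewrite sub_capmx f1 ?f2.
- by rewrite (submx_trans (capmxSl _ _)) ?z1.
Qed.

(** The sorted jumps up to t are e_0, ..., e_(m-1) with m = [m t] below, so S t
    is the value of S at e_(m-1), or the whole space if m = 0; these values form
    a chain to which [eigenspan_chain] applies. *)
Lemma step_family_realized s S : step_family s S ->
  exists2 X, X \is hermsymmx & forall t, (eigenspan_gt X t :=: S t)%MS.
Proof.
move=> [Smono Sstep Sfull S0]; pose es := sort <=%O s; pose n := size es.
have in_es x : (x \in es) = (x \in s) by rewrite mem_sort.
have es_le i j : (i <= j < n)%N -> es`_i <= es`_j.
  move=> /andP[ij jn]; apply: (sorted_leq_nth le_trans le_refl) => //.
  - exact: sort_le_sorted.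
  - exact: leq_ltn_trans jn.
(* The shift puts the whole space, the value of S below all of s, at 0. *)
pose P k : 'M[R[i]]_d := if k is k'.+1 then proj_ortho (S es`_k') else 1%:M.
pose m t := find (fun x => t < x) es.
have mP t k : (k < n)%N -> (t < es`_k) = (m t <= k)%N.
  move=> kn; case: leqP => [mk|/(before_find 0)//].
  have mkn : (m t <= k < n)%N by rewrite mk.
  apply: lt_le_trans (es_le _ _ mkn).
  by apply: (nth_find 0); rewrite has_find (leq_ltn_trans mk).
have Pm t : (P (m t) :=: S t)%MS.
  case Em: (m t) => [|k] /=.
    apply/eqmxP; rewrite submx1 andbT Sfull // => x.
    rewrite -in_es => /(nthP 0)[k kn <-].
    by rewrite mP // Em.
  have kn : (k < n)%N by rewrite -Em find_size.
  apply: eqmx_trans (proj_orthoE _) _; rewrite (Sstep _ t) // => x.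
  rewrite -in_es => /(nthP 0)[l ln <-]; rewrite [RHS]mP // Em.
  case: leqP => [lk|kl]; first by rewrite le_gtF // es_le // lk.
  have kt : es`_k <= t by rewrite leNgt mP // Em ltnn.
  by rewrite (le_lt_trans kt) // mP // Em.
(* P n is the value of S at the largest element of s; if s is empty the space
   itself is zero and P 0 = 1 = 0. *)
have Pn : P n = 0.
  have le_last x : x \in s -> x <= last 0 es.
    rewrite -in_es => /(nthP 0)[l ln <-]; rewrite -nth_last; apply: es_le.
    have n0 : (0 < size es)%N := leq_ltn_trans (leq0n l) ln.
    by rewrite -[(l <= _)%N]ltnS ltn_predL prednK // ln.
  have <- : m (last 0 es) = n.
    apply: hasNfind; apply/hasPn => x; rewrite in_es => /le_last.
    by rewrite leNgt.
  by apply/eqP; rewrite -submx0 Pm; apply: S0.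
have Pt k : P k ^t* = P k.
  by case: k => [|k]; [rewrite trmx1 map_mx1|exact: proj_ortho_trmxC].
have PP i j : (i <= j <= n)%N -> P i *m P j = P j /\ P j *m P i = P j.
  case: i j => [|i] [|j] //= ijn; rewrite ?mul1mx ?mulmx1 //.
  have Sij : (S es`_j <= S es`_i)%MS by apply: Smono; apply: es_le.
  by split; [exact: proj_orthoS_mull|exact: proj_orthoS_mulr].
have er k : (es`_k)%:C \is Num.real by apply/complex_realP; exists es`_k.
have [X hX XP] := eigenspan_chain Pt PP (erefl _) Pn er.
exists X => // t; apply: eqmx_trans (Pm t); apply: (XP (fun z => t%:C < z)).
  exact: find_size.
by move=> k kn; rewrite ltcR mP.
Qed.

(** * Join and meet *)

(** A realization J of the family S_A + S_B is a join of A and B; antisymmetry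
    of inclusion then identifies the spectral subspaces of J with those of the
    join chosen by [spectral_join]. *)
Lemma spectral_join_eigenspan_gt A B t : A \is hermsymmx -> B \is hermsymmx ->
  spectral_join A B \is hermsymmx /\
  (eigenspan_gt (spectral_join A B) t :=:
     eigenspan_gt A t + eigenspan_gt B t)%MS.
Proof.
move=> hA hB.
have sA : {subset eigs A <= eigs A ++ eigs B}.
  by move=> x; rewrite mem_cat => ->.
have sB : {subset eigs B <= eigs A ++ eigs B}.
  by move=> x; rewrite mem_cat orbC => ->.
have [J hJ JE] := step_family_realized (step_family_adds
  (step_family_eigenspan_gt hA sA) (step_family_eigenspan_gt hB sB)).
have AJ : spectral_le A J by apply/spectral_leP => u; rewrite (JE u) addsmxSl.
have BJ : spectral_le B J by apply/spectral_leP => u; rewrite JE addsmxSr.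
have [|hj Aj Bj jmin] := @xgetPex _ 0 (is_spectral_join A B).
  exists J; split; [exact: hJ|exact: AJ|exact: BJ|].
  move=> K _ /spectral_leP AK /spectral_leP BK.
  apply/spectral_leP => u; have /eqmxP/andP[JS _] := JE u.
  by apply: submx_trans JS _; rewrite addsmx_sub; apply/andP; split;
    [exact: AK|exact: BK].
split=> //; apply/eqmxP/andP; split.
  have /eqmxP/andP[JS _] := JE t; apply: submx_trans JS.
  by have /spectral_leP := jmin J hJ AJ BJ; exact.
rewrite addsmx_sub; apply/andP; split.
  by have /spectral_leP := Aj; exact.
by have /spectral_leP := Bj; exact.
Qed.

Lemma spectral_meet_eigenspan_gt A B t : A \is hermsymmx -> B \is hermsymmx ->
  spectral_meet A B \is hermsymmx /\
  (eigenspan_gt (spectral_meet A B) t :=: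
     eigenspan_gt A t :&: eigenspan_gt B t)%MS.
Proof.
move=> hA hB.
have sA : {subset eigs A <= eigs A ++ eigs B}.
  by move=> x; rewrite mem_cat => ->.
have sB : {subset eigs B <= eigs A ++ eigs B}.
  by move=> x; rewrite mem_cat orbC => ->.
have [M hM ME] := step_family_realized (step_family_cap
  (step_family_eigenspan_gt hA sA) (step_family_eigenspan_gt hB sB)).
have MA : spectral_le M A by apply/spectral_leP => u; rewrite ME capmxSl.
have MB : spectral_le M B by apply/spectral_leP => u; rewrite ME capmxSr.
have [|hm mA mB mmax] := @xgetPex _ 0 (is_spectral_meet A B).
  exists M; split; [exact: hM|exact: MA|exact: MB|].
  move=> K _ /spectral_leP KA /spectral_leP KB.
  apply/spectral_leP => u; have /eqmxP/andP[_ SM] := ME u.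
  by apply: submx_trans SM; rewrite sub_capmx; apply/andP; split;
    [exact: KA|exact: KB].
split=> //; apply/eqmxP/andP; split.
  rewrite sub_capmx; apply/andP; split.
    by have /spectral_leP := mA; exact.
  by have /spectral_leP := mB; exact.
have /eqmxP/andP[_ SM] := ME t; apply: submx_trans SM _.
by have /spectral_leP := mmax M hM MA MB; exact.
Qed.

(** * The trace identity *)

Lemma hs_norm_sqr X : X \is hermsymmx -> hs_norm X ^+ 2 = \tr (X *m X).
Proof. by move=> /hermsymmxP hX; rewrite /hs_norm sqrtCK hX. Qed.

Lemma hs_norm_sqr_eigs X : X \is hermsymmx ->
  hs_norm X ^+ 2 = \sum_(x <- eigs X) x%:C ^+ 2.
Proof.
move=> hX; rewrite hs_norm_sqr // mxtrace_sqr ?hermitian_normalmx //.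
by rewrite spectrumE // big_map.
Qed.

Lemma perm_eigs_join_meet A B : A \is hermsymmx -> B \is hermsymmx ->
  perm_eq (eigs (spectral_join A B) ++ eigs (spectral_meet A B))
          (eigs A ++ eigs B).
Proof.
move=> hA hB; apply: perm_eq_count_gt => t; rewrite !count_cat.
have [hJ JE] := spectral_join_eigenspan_gt t hA hB.
have [hM ME] := spectral_meet_eigenspan_gt t hA hB.
have rk X (hX : X \is hermsymmx) := esym (rank_eigenspan_gt t hX).
apply: etrans (congr2 addn (etrans (rk _ hJ) JE.1) (etrans (rk _ hM) ME.1)) _.
apply: etrans (mxrank_sum_cap _ _) _.
exact: congr2 (esym (rk _ hA)) (esym (rk _ hB)).
Qed.

(** The norms see only the eigenvalues, so the hypothesis gives
    ||J||^2 + ||M||^2 = ||A||^2 + ||B||^2, and polarization concludes. *)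
Lemma mxtrace_mul_perm_eigs A B J M :
    A \is hermsymmx -> B \is hermsymmx -> J \is hermsymmx -> M \is hermsymmx ->
    perm_eq (eigs J ++ eigs M) (eigs A ++ eigs B) ->
  \tr (A *m B) =
    2^-1 * (hs_norm (A + B) ^+ 2 - hs_norm J ^+ 2 - hs_norm M ^+ 2).
Proof.
move=> hA hB hJ hM JM_AB.
have hAB : A + B \is hermsymmx.
  apply/hermsymmxP; rewrite linearD map_mxD.
  by have /hermsymmxP -> := hA; have /hermsymmxP -> := hB.
have sum2 X Y : X \is hermsymmx -> Y \is hermsymmx ->
    hs_norm X ^+ 2 + hs_norm Y ^+ 2 = \sum_(x <- eigs X ++ eigs Y) x%:C ^+ 2.
  by move=> hX hY; rewrite big_cat (hs_norm_sqr_eigs hX) (hs_norm_sqr_eigs hY).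
have JM : hs_norm J ^+ 2 + hs_norm M ^+ 2 = \tr (A *m A) + \tr (B *m B).
  apply: etrans (sum2 _ _ hJ hM) _; apply: etrans (perm_big _ JM_AB) _.
  apply: etrans (esym (sum2 _ _ hA hB)) _.
  exact: congr2 (hs_norm_sqr hA) (hs_norm_sqr hB).
by rewrite -addrA -opprD JM (hs_norm_sqr hAB) mxtrace_polarization.
Qed.

End SpectralOrder.

Unset Implicit Arguments.

Theorem proposition3p2 (R : realType) (d : nat) (A B : 'M[R[i]]_d)
    (psdA : psdmx A) (psdB : psdmx B) :
  \tr (A *m B) =
    2^-1 * (hs_norm (A + B) ^+ 2 - hs_norm (spectral_join A B) ^+ 2
            - hs_norm (spectral_meet A B) ^+ 2).
Proof.
have [[hA _] [hB _]] := (psdA, psdB).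
apply: mxtrace_mul_perm_eigs; [exact: hA|exact: hB| | |].
- by have [] := spectral_join_eigenspan_gt 0 hA hB.
- by have [] := spectral_meet_eigenspan_gt 0 hA hB.
- exact: perm_eigs_join_meet.
Qed.
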